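(* Let $(X_n)$ be a sequence of real-valued random variables, with integrated quantile functions $\mathsf K_{X_n}$. The following statements are equivalent: (i) The sequence $(X_n)$ weakly converges. (ii) There is a sequence $(c_n)$ of (real) numbers such that, for every $u\in(0,1)$, the sequence $(\mathsf K_{X_n}(u)-c_n)$ converges to a finite limit. (iii) The sequence $(\mathsf K_{X_n})$ converges uniformly on every $[\alpha,\beta]\subseteq(0,1)$. Moreover, in this case, if $X$ is a weak limit of $(X_n)$, then $\mathsf K_X(u)=\lim_{n\to\infty}\mathsf K_{X_n}(u)$ for all $u\in(0,1)$.
   Context: For a random variable $X$ with distribution function $F_X(x)=\mathsf P(X\le x)$, the integrated distribution function is $\mathsf J_X(x)=\int_0^xF_X(t)\,dt$, $x\in\mathbb R$ (with $\int_a^b:=-\int_b^a$ if $b<a$), and the integrated quantile function is its Fenchel transform $\mathsf K_X(u)=\sup_{x\in\mathbb R}\{xu-\mathsf J_X(x)\}$, $u\in\mathbb R$; it is finite on $(0,1)$. Weak convergence of $(X_n)$ means convergence in distribution to some real-valued random variable (the $X_n$ may live on different probability spaces). Uniform convergence in (iii) is to a finite-valued function. *)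

(* Defs.v *)
From HB Require Import structures.
From mathcomp Require Import all_boot all_order all_algebra.
From mathcomp Require Import ring lra.
From mathcomp Require Import all_classical all_reals all_analysis measurable_realfun.
Set Implicit Arguments.
Unset Strict Implicit.
Unset Printing Implicit Defensive.
Import Order.TTheory GRing.Theory Num.Theory.
Import numFieldNormedType.Exports.
Local Open Scope classical_set_scope.
Local Open Scope ring_scope.

Definition oriented_integral (R : realType) (a b : R) (f : R -> R) : R :=
  if a <= b then Rintegral lebesgue_measure `[a, b] f
  else - Rintegral lebesgue_measure `[b, a] f.

(* [cdf] is [\bar R]-valued in the library; as [P] is a probability, its values
   are finite and [fine] loses nothing. *)
Definition integrated_distribution (R : realType) (d : measure_display)
    (T : measurableType d) (P : probability T R) (X : {RV P >-> R}) (x : R) : R :=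
  oriented_integral 0 x (fun t => fine (cdf X t)).

Definition fenchel (R : realType) (f : R -> R) (u : R) : \bar R :=
  ereal_sup (range (fun x : R => (x * u - f x)%:E)).

Definition integrated_quantile (R : realType) (d : measure_display)
    (T : measurableType d) (P : probability T R) (X : {RV P >-> R}) (u : R) :
    \bar R :=
  fenchel (integrated_distribution X) u.

(* The [X n] and [Y] may live on different probability spaces: only their
   distribution functions are compared. *)
Definition cvg_in_distribution (R : realType) (d : nat -> measure_display)
    (T : forall n, measurableType (d n)) (P : forall n, probability (T n) R)
    (X : forall n, {RV (P n) >-> R})
    (d' : measure_display) (T' : measurableType d') (Q : probability T' R)
    (Y : {RV Q >-> R}) : Prop :=
  forall x : R, {for x, continuous (cdf Y)} ->
    cdf (X n) x @[n --> \oo] --> cdf Y x.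

Definition weakly_convergent (R : realType) (d : nat -> measure_display)
    (T : forall n, measurableType (d n)) (P : forall n, probability (T n) R)
    (X : forall n, {RV (P n) >-> R}) : Prop :=
  exists (d' : measure_display) (T' : measurableType d')
    (Q : probability T' R) (Y : {RV Q >-> R}), cvg_in_distribution X Y.

(* [integrated_quantile X] is finite on (0, 1), so that [fine] loses nothing
   there. *)
Section finiteness.
Context (R : realType) (d : measure_display) (T : measurableType d)
  (P : probability T R) (X : {RV P >-> R}).
Let F t := fine (cdf X t).
Local Notation mu := (@lebesgue_measure R).

Let F_ge0 t : 0 <= F t. Proof. by rewrite fine_ge0 ?cdf_ge0. Qed.

Let F_le1 t : F t <= 1.
Proof. by rewrite -lee_fin fineK ?fin_num_measure ?cdf_le1. Qed.

Let F_nd s t : s <= t -> F s <= F t.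
Proof. by move=> st; rewrite fine_le ?fin_num_measure// cdf_nondecreasing. Qed.

Let mu_lty (a b : R) : (mu `[a, b]%classic < +oo)%E.
Proof. by rewrite lebesgue_measure_itv/=; case: ifPn; rewrite -?EFinD ltry. Qed.

Let F_int a b : mu.-integrable `[a, b] (EFin \o F).
Proof.
apply: measurable_bounded_integrable => //.
- exact: mu_lty.
- apply: measurable_funTS; apply/measurable_EFinP.
  apply: eq_measurable_fun (cdf_measurable X) => t _.
  by rewrite /= fineK ?fin_num_measure.
- exists 1; split => // M M1 t _ /=.
  by rewrite ger0_norm ?F_ge0// (le_trans (F_le1 t)) ?ltW.
Qed.

Let mu_itv a b : a <= b -> fine (mu `[a, b]) = b - a.
Proof.
rewrite le_eqVlt => /predU1P[->|ab].
  by rewrite lebesgue_measure_itv/= ltxx subrr.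
by rewrite lebesgue_measure_itv/= lte_fin ab.
Qed.

Let cst_int a b c : mu.-integrable `[a, b] (EFin \o cst c).
Proof.
apply: measurable_bounded_integrable => //.
- exact: mu_lty.
- exists `|c|; split => // M M1 t _ /=; exact: ltW.
Qed.

Let int_ge a b c : a <= b -> (forall t, a <= t <= b -> c <= F t) ->
  c * (b - a) <= Rintegral mu `[a, b] F.
Proof.
move=> ab cF; rewrite -mu_itv// -Rintegral_cst//.
apply: le_Rintegral; [by []|exact: cst_int|exact: F_int|].
by move=> t; rewrite /= in_itv/= => /cF.
Qed.

Let int_le a b c : a <= b -> (forall t, a <= t <= b -> F t <= c) ->
  Rintegral mu `[a, b] F <= c * (b - a).
Proof.
move=> ab cF; rewrite -mu_itv// -Rintegral_cst//.
apply: le_Rintegral; [by []|exact: F_int|exact: cst_int|].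
by move=> t; rewrite /= in_itv/= => /cF.
Qed.

Let int_split a b c : a <= b -> b <= c -> Rintegral mu `[a, c] F =
  Rintegral mu `[a, b] F + Rintegral mu `[b, c] F.
Proof.
move=> ab bc.
have H : Rintegral mu `[a, c] F - Rintegral mu `[a, b] F = Rintegral mu `]b, c] F.
  by apply: Rintegral_itvB; rewrite ?bnd_simp//; exact: F_int.
rewrite -(Rintegral_itv_obnd_cbnd (r := b) (b := BRight c)).
  by rewrite -[X in _ + X]H addrC subrK.
apply: (@integrableS _ _ _ mu `[b, c]%classic `]b, c]%classic) (F_int b c) => //.
by apply: subset_itvr; rewrite bnd_simp.
Qed.

Lemma integrated_quantile_fin_num (u : R) : 0 < u < 1 ->
  integrated_quantile X u \is a fin_num.
Proof.
move=> /andP[u0 u1].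
have cFy : F t @[t --> +oo] --> (1 : R) by exact/fine_cvg/cvg_cdfy1.
have cFN : F t @[t --> -oo] --> (0 : R) by exact/fine_cvg/cvg_cdfNy0.
have [a [a0 uFa]] : exists a, 0 < a /\ u < F a.
  near (+oo : set_system R) => a; exists a; split; first by near: a; exact: nbhs_pinfty_gt.
  by near: a; move/cvgr_gt : cFy; exact.
have [b [b0 Fbu]] : exists b, b < 0 /\ F b < u.
  near (-oo : set_system R) => b; exists b; split; first by near: b; exact: nbhs_ninfty_lt.
  by near: b; move/cvgr_lt : cFN; exact.
apply/fin_numPlt/andP; split.
  apply: lt_le_trans (ltNyr (0 * u - integrated_distribution X 0)) _.
  by apply: ereal_sup_ubound; exists 0.
apply: (@le_lt_trans _ _ (u * a - b)%:E); last exact: ltry.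
apply: ge_ereal_sup => _ [x _ <-]; rewrite lee_fin.
rewrite /integrated_distribution /oriented_integral -/F; have [x0|x0] := leP 0 x.
  have [ax|xa] := leP a x.
    rewrite (int_split (ltW a0) ax).
    have := int_ge (ltW a0) (fun t _ => F_ge0 t).
    have : F a * (x - a) <= Rintegral mu `[a, x] F.
      by apply: int_ge => // t /andP[at_ _]; exact: F_nd.
    by nra.
  by have := int_ge x0 (fun t _ => F_ge0 t); nra.
have [xb|bx] := leP x b.
  rewrite (int_split xb (ltW b0)).
  have := int_le (ltW b0) (fun t _ => F_le1 t).
  have : Rintegral mu `[x, b] F <= F b * (b - x).
    by apply: int_le => // t /andP[_ tb]; exact: F_nd.
  by nra.
by have := int_le (ltW x0) (fun t _ => F_le1 t); nra.
Unshelve. all: by end_near. Qed.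

End finiteness.

(* Main.v *)
(* Write F, J, K for the distribution function, the integrated distribution
   function and the integrated quantile function. As F x is a subgradient of J
   at x, the supremum defining K u may be restricted to any [b, a] with
   F b <= u <= F a, and the chord of K over [w, v] has slope at most x when
   v <= F x and at least x when F x <= w.

   If X_n tends to Y weakly, choose continuity points b < 0 < a of F_Y with
   F_Y b < alpha and beta < F_Y a. For large n and u in [alpha, beta] both
   suprema are over [b, a], so |K_n u - K_Y u| is at most the integral of
   |F_n - F_Y| over [b, a], which tends to 0 by dominated convergence, F_Y
   having countably many discontinuities.

   Conversely, the slopes of the chords of K_n do not see the constants c_n. If
   they converge to those of some k, the bounds on the slopes show that F_n
   converges, at its continuity points, to the inverse of the slope of k, which
   is the distribution function of a probability measure on R. *)
Require Import Defs.
From HB Require Import structures.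
From mathcomp Require Import all_boot all_order all_algebra.
From mathcomp Require Import ring lra.
From mathcomp Require Import all_classical all_reals all_analysis.
From mathcomp Require Import measurable_realfun.
Import Order.TTheory GRing.Theory Num.Theory.
Import numFieldNormedType.Exports.
Local Open Scope classical_set_scope.
Local Open Scope ring_scope.

Definition rcdf {R : realType} {d : measure_display} {T : measurableType d}
  {P : probability T R} (X : {RV P >-> R}) (t : R) : R := fine (cdf X t).

Definition rquantile {R : realType} {d : measure_display}
  {T : measurableType d} {P : probability T R} (X : {RV P >-> R}) (u : R) : R :=
  fine (integrated_quantile X u).

(** * Integrals over compact intervals *)

Section interval_integrals.
Set Implicit Arguments.
Unset Strict Implicit.
Context (R : realType).
Local Notation mu := (@lebesgue_measure R).

Lemma lebesgue_itvcc_lty (a b : R) : (mu `[a, b]%classic < +oo)%E.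
Proof. by rewrite lebesgue_measure_itv/=; case: ifPn; rewrite -?EFinD ltry. Qed.

Lemma Rintegral_itvcc_split (f : R -> R) a b c :
  mu.-integrable `[a, c] (EFin \o f) -> a <= b -> b <= c ->
  Rintegral mu `[a, c] f = Rintegral mu `[a, b] f + Rintegral mu `[b, c] f.
Proof.
move=> fi ab bc.
have H : Rintegral mu `[a, c] f - Rintegral mu `[a, b] f =
    Rintegral mu `]b, c] f.
  by apply: Rintegral_itvB; rewrite ?bnd_simp.
rewrite -(Rintegral_itv_obnd_cbnd (r := b) (b := BRight c)).
  by rewrite -[X in _ + X]H addrC subrK.
apply: integrableS fi => //.
by apply: subset_itvr; rewrite bnd_simp.
Qed.

Lemma integrable_itvcc_cst a b c : mu.-integrable `[a, b] (EFin \o cst c).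
Proof.
apply: measurable_bounded_integrable => //.
- exact: lebesgue_itvcc_lty.
- by exists `|c|; split => // M M1 t _ /=; exact: ltW.
Qed.

Lemma Rintegral_itvcc_cst a b c : a <= b ->
  Rintegral mu `[a, b] (cst c) = c * (b - a).
Proof.
move=> ab; have <- : fine (mu `[a, b]) = b - a; last exact: Rintegral_cst.
rewrite lebesgue_measure_itv/= lte_fin; case: ltP => //= ba.
by apply/esym/eqP; rewrite subr_eq0 eq_le ba ab.
Qed.

End interval_integrals.

(** * Convex duality between the integrated distribution and quantile functions *)

Section one_variable.
Set Implicit Arguments.
Unset Strict Implicit.
Context (R : realType) (d : measure_display) (T : measurableType d)
  (P : probability T R) (X : {RV P >-> R}).
Local Notation mu := (@lebesgue_measure R).
Local Notation F := (rcdf X).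
Local Notation J := (integrated_distribution X).
Local Notation K := (rquantile X).

Lemma rcdf_ge0 t : 0 <= F t. Proof. by rewrite /rcdf fine_ge0 ?cdf_ge0. Qed.

Lemma rcdf_le1 t : F t <= 1.
Proof. by rewrite /rcdf -lee_fin fineK ?fin_num_measure ?cdf_le1. Qed.

Lemma rcdf_nd : {homo F : s t / s <= t}.
Proof.
by move=> s t st; rewrite /rcdf fine_le ?fin_num_measure// cdf_nondecreasing.
Qed.

Lemma cvg_rcdfy1 : F t @[t --> +oo] --> (1 : R).
Proof. exact/fine_cvg/cvg_cdfy1. Qed.

Lemma cvg_rcdfNy0 : F t @[t --> -oo] --> (0 : R).
Proof. exact/fine_cvg/cvg_cdfNy0. Qed.

Lemma measurable_rcdf : measurable_fun setT F.
Proof.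
apply/measurable_EFinP; apply: eq_measurable_fun (cdf_measurable X) => t _.
by rewrite /= /rcdf fineK ?fin_num_measure.
Qed.

Lemma integrable_rcdf a b : mu.-integrable `[a, b] (EFin \o F).
Proof.
apply: measurable_bounded_integrable => //.
- exact: lebesgue_itvcc_lty.
- by apply: measurable_funTS; exact: measurable_rcdf.
- exists 1; split => // M M1 t _ /=.
  by rewrite ger0_norm ?rcdf_ge0// (le_trans (rcdf_le1 t)) ?ltW.
Qed.

Lemma integrated_distributionB a b : a <= b ->
  J b - J a = Rintegral mu `[a, b] F.
Proof.
move=> ab; rewrite /integrated_distribution /oriented_integral.
have [b0|b0] := leP 0 b; have [a0|a0] := leP 0 a.
- by rewrite (Rintegral_itvcc_split (integrable_rcdf 0 b) a0 ab) addrC addKr.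
- rewrite (Rintegral_itvcc_split (integrable_rcdf a b) (ltW a0) b0); ring.
- lra.
- rewrite (Rintegral_itvcc_split (integrable_rcdf a 0) ab (ltW b0)); ring.
Qed.

(** By monotonicity, [F] on the interval between [x] and [y] lies above [F x] if [x <= y] and below
    it if [y <= x]; the sign of [y - x] makes both cases the same inequality. *)
Lemma integrated_distribution_subgradient x y : F x * (y - x) <= J y - J x.
Proof.
have [xy|/ltW yx] := leP x y.
  rewrite integrated_distributionB// -Rintegral_itvcc_cst//.
  apply: le_Rintegral => //;
    [exact: integrable_itvcc_cst|exact: integrable_rcdf|].
  by move=> t; rewrite /= in_itv/= => /andP[xt _]; exact: rcdf_nd.
rewrite -lerN2 opprB integrated_distributionB// -mulrN opprB.
rewrite -Rintegral_itvcc_cst//.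
apply: le_Rintegral => //;
  [exact: integrable_rcdf|exact: integrable_itvcc_cst|].
by move=> t; rewrite /= in_itv/= => /andP[_ xt]; exact: rcdf_nd.
Qed.

Lemma integrated_quantile_ub u x : 0 < u < 1 -> x * u - J x <= K u.
Proof.
move=> u01; rewrite /rquantile -lee_fin fineK;
  last exact: integrated_quantile_fin_num.
by apply: ereal_sup_ubound; exists x.
Qed.

Lemma integrated_quantile_le u c : 0 < u < 1 ->
  (forall x, x * u - J x <= c) -> K u <= c.
Proof.
move=> u01 H; rewrite /rquantile -lee_fin fineK;
  last exact: integrated_quantile_fin_num.
by apply: ge_ereal_sup => _ [x _ <-]; rewrite lee_fin.
Qed.

(** The subgradient inequality at [b], with [F b <= u], shows that [x * u - J x] on the left of [b]
    is at most its value at [b]; likewise on the right of [a]. *)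
Lemma integrated_quantile_le_itv u a b c : 0 < u < 1 -> b <= a ->
  F b <= u <= F a ->
  (forall x, b <= x <= a -> x * u - J x <= c) -> K u <= c.
Proof.
move=> u01 ba /andP[Fbu uFa] H; apply: integrated_quantile_le => // x.
have [xb|/ltW bx] := leP x b.
  apply: le_trans (H b _); last by rewrite lexx.
  have := integrated_distribution_subgradient b x; nra.
have [ax|xa] := leP a x; last by apply: H; rewrite bx ltW.
apply: le_trans (H a _); last by rewrite lexx andbT.
have := integrated_distribution_subgradient a x; nra.
Qed.

(** Each [y * v - J y] is at most [K w + x * (v - w)]: for [y <= x], write [y * v] as
    [y * w + y * (v - w)]; for [y >= x], the subgradient [F x >= v] reduces to [y = x]. *)
Lemma integrated_quantile_slope_le x w v : 0 < w -> w <= v -> v < 1 ->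
  v <= F x -> K v - K w <= x * (v - w).
Proof.
move=> w0 wv v1 vF.
have w01 : 0 < w < 1 by rewrite w0 (le_lt_trans wv).
rewrite lerBlDl; apply: integrated_quantile_le => [|y].
  by rewrite v1 (lt_le_trans w0).
have [yx|/ltW xy] := leP y x.
  have := integrated_quantile_ub y w01; nra.
have := integrated_quantile_ub x w01.
have := integrated_distribution_subgradient x y.
have : v * (y - x) <= F x * (y - x) by rewrite ler_wpM2r ?subr_ge0.
by move: (J x) (J y) (K w) => *; lra.
Qed.

Lemma integrated_quantile_slope_ge x w v : 0 < w -> w <= v -> v < 1 ->
  F x <= w -> x * (v - w) <= K v - K w.
Proof.
move=> w0 wv v1 Fw.
have v01 : 0 < v < 1 by rewrite v1 (lt_le_trans w0).
rewrite lerBrDl -lerBrDr; apply: integrated_quantile_le => [|y].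
  by rewrite w0 (le_lt_trans wv).
have [xy|/ltW yx] := leP x y.
  have := integrated_quantile_ub y v01; nra.
have := integrated_quantile_ub x v01.
have := integrated_distribution_subgradient x y.
have : w * (y - x) <= F x * (y - x) by rewrite ler_wnM2r ?subr_le0.
by move: (J x) (J y) (K v) => *; lra.
Qed.

End one_variable.

(** * Continuity points of right-continuous monotone functions *)

Section discontinuities.
Set Implicit Arguments.
Unset Strict Implicit.
Context (R : realType) (f : R -> R).
Hypothesis f_nd : {homo f : s t / s <= t}.
Hypothesis f_rc : right_continuous f.

(** One-sided limits exist by monotonicity and right continuity, so every point of discontinuity is
    a jump; the jumps in each []-n, n[] are countably many. *)
Lemma nd_rc_countable_discontinuity :
  countable [set x | ~ {for x, continuous f}].
Proof.
pose D (n : nat) :=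
  [set x : R | x \in (`](- n%:R), n%:R[) /\ discontinuity f x].
apply: (@sub_countable _ _ _ (\bigcup_n D n)); last first.
  apply: bigcup_countable => // n _; apply: discontinuity_countable.
  by move=> x y _ _; exact: f_nd.
apply: subset_card_le => x /= fx.
have fl : cvg (f t @[t --> x^'-]).
  apply: nondecreasing_at_left_is_cvgr.
    by near=> y => s t _ _; exact: f_nd.
  near=> y; exists (f x) => _ [t /= /[!in_itv]/= /andP[_ /ltW tx] <-].
  exact: f_nd.
have fr : cvg (f t @[t --> x^'+]) by apply/cvg_ex; exists (f x); exact: f_rc.
exists (Num.truncn `|x|).+1 => //; split.
  by rewrite in_itv/= -ltr_norml truncnS_gt.
split=> //; apply/eqP => flr; apply: fx; apply/left_right_continuousP.
split; last exact: f_rc.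
by move: fl; rewrite /cvg_to flr (cvg_lim _ (f_rc (x := x))).
Unshelve. all: by end_near. Qed.

(** Otherwise []a, b[] would be countable, hence of measure 0. *)
Lemma nd_rc_continuity_point a b : a < b ->
  exists2 x, a < x < b & {for x, continuous f}.
Proof.
move=> ab; apply: contrapT => nex.
have : lebesgue_measure `]a, b[%classic = 0%E.
  apply: countable_lebesgue_measure0.
  apply: sub_countable nd_rc_countable_discontinuity.
  apply: subset_card_le => x /= /[!in_itv]/= axb fx.
  by apply: nex; exists x.
rewrite lebesgue_measure_itv/= lte_fin ab -EFinB => -[] /eqP.
by rewrite subr_eq0 gt_eqF.
Qed.

End discontinuities.

(** * Distance between two integrated quantile functions *)

Section two_variables.
Set Implicit Arguments.
Unset Strict Implicit.
Context (R : realType) (d d' : measure_display)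
  (T : measurableType d) (T' : measurableType d')
  (P : probability T R) (Q : probability T' R)
  (X : {RV P >-> R}) (Y : {RV Q >-> R}).
Local Notation mu := (@lebesgue_measure R).
Local Notation F := (rcdf X).
Local Notation G := (rcdf Y).

Lemma integrable_rcdfB a b :
  mu.-integrable `[a, b] (EFin \o (fun t => F t - G t)).
Proof.
exact: (integrableB _ (integrable_rcdf X a b) (integrable_rcdf Y a b)).
Qed.

Lemma integrable_norm_rcdfB a b :
  mu.-integrable `[a, b] (EFin \o (fun t => `|F t - G t|)).
Proof. exact: (integrable_norm (integrable_rcdfB a b)). Qed.

(** As [0] and [x] both lie in [[b, a]], so does the domain of integration. *)
Lemma integrated_distribution_dist_le (a b x : R) :
  b <= 0 <= a -> b <= x <= a ->
  `|integrated_distribution X x - integrated_distribution Y x| <=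
  Rintegral mu `[b, a] (fun t => `|F t - G t|).
Proof.
move=> /andP[b0 a0] /andP[bx xa].
have sub (c e : R) : b <= c -> e <= a ->
    `|Rintegral mu `[c, e] F - Rintegral mu `[c, e] G| <=
    Rintegral mu `[b, a] (fun t => `|F t - G t|).
  move=> bc ea; rewrite -RintegralB//; try exact: integrable_rcdf.
  apply: le_trans (le_normr_Rintegral _ (integrable_rcdfB c e)) _ => //.
  apply: fine_le.
  - by apply: integrable_fin_num => //; exact: integrable_norm_rcdfB.
  - by apply: integrable_fin_num => //; exact: integrable_norm_rcdfB.
  apply: ge0_subset_integral => //.
  - exact: measurable_int (integrable_norm_rcdfB b a).
  - by apply: subset_itv; rewrite bnd_simp.
rewrite /integrated_distribution /oriented_integral.
have [x0|x0] := leP 0 x; first exact: sub.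
by rewrite -opprD normrN; exact: sub.
Qed.

(** Both suprema are over [[b, a]], where the two integrated distribution functions differ by at
    most [D]. *)
Lemma integrated_quantile_dist_le (a b u : R) : b <= 0 <= a -> 0 < u < 1 ->
  F b <= u <= F a -> G b <= u <= G a ->
  `|rquantile X u - rquantile Y u| <=
  Rintegral mu `[b, a] (fun t => `|F t - G t|).
Proof.
move=> ba0 u01 Fu Gu.
have ba : b <= a by case/andP: ba0; exact: le_trans.
set D := Rintegral _ _ _.
have JD x : b <= x <= a ->
    integrated_distribution Y x - D <= integrated_distribution X x <=
    integrated_distribution Y x + D.
  by move=> /(integrated_distribution_dist_le ba0); rewrite ler_distl.
rewrite ler_distl lerBlDr; apply/andP; split.
  apply: (integrated_quantile_le_itv u01 ba Gu) => x /JD/andP[_ JXY].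
  apply: (@le_trans _ _ (x * u - integrated_distribution X x + D)).
    by lra.
  by rewrite lerD2r; exact: integrated_quantile_ub.
apply: (integrated_quantile_le_itv u01 ba Fu) => x /JD/andP[JXY _].
apply: (@le_trans _ _ (x * u - integrated_distribution Y x + D)); first by lra.
by rewrite lerD2r; exact: integrated_quantile_ub.
Qed.

End two_variables.

(** * From weak convergence to uniform convergence of the quantile functions *)

Section convergence.
Set Implicit Arguments.
Unset Strict Implicit.
Context (R : realType) (d : nat -> measure_display)
  (T : forall n, measurableType (d n)) (P : forall n, probability (T n) R)
  (X : forall n, {RV (P n) >-> R})
  (d' : measure_display) (T' : measurableType d') (Q : probability T' R)
  (Y : {RV Q >-> R}).
Hypothesis XY : cvg_in_distribution X Y.
Local Notation mu := (@lebesgue_measure R).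
Local Notation F n := (rcdf (X n)).
Local Notation G := (rcdf Y).

Lemma rcdf_right_continuous : right_continuous G.
Proof.
move=> a; apply: fine_cvg.
by rewrite /rcdf fineK ?fin_num_measure//; exact: cdf_right_continuous.
Qed.

Lemma cvg_rcdf x : {for x, continuous G} -> F n x @[n --> \oo] --> G x.
Proof.
move=> Gx; apply: fine_cvg; rewrite fineK ?fin_num_measure//; apply: XY.
rewrite /prop_for /continuous_at -[cdf Y x]fineK ?fin_num_measure//.
by apply/cvg_EFin; [near=> y; rewrite fin_num_measure|exact: Gx].
Unshelve. all: by end_near. Qed.

Lemma cvg_Rintegral_norm_rcdfB a b :
  Rintegral mu `[b, a] (fun t => `|F n t - G t|) @[n --> \oo] --> (0 : R).
Proof.
have mFG n := measurable_int _ (integrable_norm_rcdfB (X n) Y b a).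
have FG0 : {ae mu, forall x, `[b, a]%classic x ->
    (`|F n x - G x|)%:E @[n --> \oo] --> 0%E}.
  have dG := nd_rc_countable_discontinuity (@rcdf_nd _ _ _ _ Y)
    rcdf_right_continuous.
  exists [set x | ~ {for x, continuous G}]; split.
  - exact: countable_measurable.
  - exact: countable_lebesgue_measure0.
  - move=> x /= + Gx; apply => _; apply: cvg_EFin; first by near=> n.
    by apply/norm_cvg0P/subr_cvg0; exact: cvg_rcdf.
have FG1 : {ae mu, forall x n, `[b, a]%classic x ->
    (`|(`|F n x - G x|%R)%:E| <= (EFin \o cst 1%R) x)%E}.
  apply: aeW => x n _ /=; rewrite lee_fin normr_id ler_norml.
  have := rcdf_ge0 (X n) x; have := rcdf_ge0 Y x.
  by have := rcdf_le1 (X n) x; have := rcdf_le1 Y x; lra.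
have [_ _] := @dominated_convergence _ _ _ mu _ (measurable_itv _)
  (fun n => EFin \o (fun t => `|F n t - G t|)) (cst 0%E) (EFin \o cst 1)
  mFG (measurable_cst _) FG0 (integrable_itvcc_cst b a 1) FG1.
by rewrite integral0 => H; exact: fine_cvg H.
Unshelve. all: by end_near. Qed.

Lemma integrated_quantile_unif_cvg (alpha beta e : R) : 0 < alpha -> beta < 1 ->
  0 < e -> \forall n \near \oo, forall u, alpha <= u <= beta ->
  `|rquantile (X n) u - rquantile Y u| < e.
Proof.
move=> alpha0 beta1 e0.
have G_nd := @rcdf_nd _ _ _ _ Y.
have [a [a0 Ga betaGa]] : exists a,
    [/\ 0 < a, {for a, continuous G} & beta < G a].
  near (+oo : set_system R) => M.
  have [|a /andP[Ma _] Ga] := nd_rc_continuity_point G_nd rcdf_right_continuous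
    (_ : M < M + 1); first by rewrite ltrDl.
  exists a; split => //.
    by apply: lt_trans Ma; near: M; exact: nbhs_pinfty_gt.
  apply: lt_le_trans (G_nd _ _ (ltW Ma)).
  by near: M; move/cvgr_gt : (cvg_rcdfy1 Y); exact.
have [b [b0 Gb Gbalpha]] : exists b,
    [/\ b < 0, {for b, continuous G} & G b < alpha].
  near (-oo : set_system R) => M.
  have [|b /andP[_ bM] Gb] := nd_rc_continuity_point G_nd rcdf_right_continuous
    (_ : M - 1 < M); first by rewrite gtrDl ltrN10.
  exists b; split => //.
    by apply: lt_trans bM _; near: M; exact: nbhs_ninfty_lt.
  apply: le_lt_trans (G_nd _ _ (ltW bM)) _.
  by near: M; move/cvgr_lt : (cvg_rcdfNy0 Y); exact.
(* The index is chosen before [u]: the conditions on [n] involve only [a] and [b], whence the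
   uniformity. *)
near=> n => u /andP[alphau ubeta].
apply: (@le_lt_trans _ _ (Rintegral mu `[b, a] (fun t => `|F n t - G t|))).
  apply: integrated_quantile_dist_le.
  - by rewrite !ltW.
  - by rewrite (lt_le_trans alpha0)//= (le_lt_trans ubeta).
  - apply/andP; split.
      rewrite (le_trans _ alphau)// ltW//; near: n.
      by move/cvgr_lt : (cvg_rcdf Gb); exact.
    rewrite (le_trans ubeta)// ltW//; near: n.
    by move/cvgr_gt : (cvg_rcdf Ga); exact.
  - by rewrite (le_trans (ltW Gbalpha))//= (le_trans ubeta)// ltW.
near: n; move/cvgr_lt : (cvg_Rintegral_norm_rcdfB a b); exact.
Unshelve. all: by end_near. Qed.

Lemma cvg_integrated_quantile u : 0 < u < 1 ->
  integrated_quantile (X n) u @[n --> \oo] --> integrated_quantile Y u.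
Proof.
move=> u01; have /andP[u0 u1] := u01.
rewrite -[integrated_quantile Y u]fineK;
  last exact: integrated_quantile_fin_num.
apply/cvg_EFin; first by near=> n; exact: integrated_quantile_fin_num.
apply/cvgrPdist_lt => e e0; near=> n; rewrite distrC.
have : forall t, u <= t <= u -> `|rquantile (X n) t - rquantile Y t| < e.
  by near: n; exact: integrated_quantile_unif_cvg.
by apply; rewrite lexx.
Unshelve. all: by end_near. Qed.

Lemma uniform_cvg_rquantile alpha beta : `[alpha, beta] `<=` `]0, 1[ ->
  {uniform `[alpha, beta], (fun n => rquantile (X n)) @ \oo --> rquantile Y}.
Proof.
move=> ab01 A /uniform_nbhs[E [entE EA]].
have [e /= e0 eE] : exists2 e : R, 0 < e & forall x y, `|x - y| < e -> E (x, y).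
  move: entE; rewrite -entourage_ballE => -[e /= e0 eE].
  by exists e => // x y xy; exact: eE.
rewrite nbhs_simpl/=.
(* An empty interval puts no constraint on its endpoints, so this case is set apart. *)
have [ab|ba] := leP alpha beta; last first.
  near=> n; apply: EA => u /=; rewrite in_itv/= => /andP[au ub].
  by have := le_trans au ub; rewrite leNgt ba.
have a0 : 0 < alpha.
  have /ab01 : `[alpha, beta]%classic alpha by rewrite /= in_itv/= lexx ab.
  by rewrite /= in_itv/= => /andP[].
have b1 : beta < 1.
  have /ab01 : `[alpha, beta]%classic beta by rewrite /= in_itv/= lexx ab.
  by rewrite /= in_itv/= => /andP[].
near=> n; apply: EA => u /=; rewrite in_itv/= => uab; apply: eE; rewrite distrC.
by move: u uab; near: n; exact: integrated_quantile_unif_cvg.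
Unshelve. all: by end_near. Qed.

End convergence.

(** * A candidate limit distribution function: the inverse slope of [k] *)

Section limit_distribution.
Set Implicit Arguments.
Unset Strict Implicit.
Context (R : realType) (k : R -> R).

(* The points of (0, 1) with a chord of [k] to their left steeper than [x]:
   for convex [k] they form an interval ending at 1 and starting where the slope
   of [k] exceeds [x], so their infimum inverts the slope of [k]. *)
Definition steep (x : R) : set R := [set v | v = 1 \/
  0 < v < 1 /\ exists2 w, 0 < w < v & x * (v - w) < k v - k w].

Definition slope_inverse (x : R) : R := inf (steep x).

Local Notation G := slope_inverse.

Lemma has_lbound_steep x : has_lbound (steep x).
Proof. by exists 0 => v [->|[/andP[/ltW]]]. Qed.

Lemma steep1 x : steep x 1. Proof. by left. Qed.

(** The clause [v = 1] keeps the set nonempty when no chord is steeper than [x]; the infimum is then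
    1. *)
Lemma has_inf_steep x : has_inf (steep x).
Proof. by split; [exists 1; exact: steep1|exact: has_lbound_steep]. Qed.

Lemma slope_inverse_le x v : steep x v -> G x <= v.
Proof. by apply: ge_inf; exact: has_lbound_steep. Qed.

Lemma slope_inverse_le1 x : G x <= 1.
Proof. exact/slope_inverse_le/steep1. Qed.

Lemma slope_inverse_ge x c : (forall v, steep x v -> c <= v) -> c <= G x.
Proof. by move=> H; apply: lb_le_inf => //; exists 1; exact: steep1. Qed.

Lemma slope_inverse_ge0 x : 0 <= G x.
Proof. by apply: slope_inverse_ge => v [->|[/andP[/ltW]]]. Qed.

Lemma slope_inverse_lt_notin x v w : 0 < w < v -> v < G x ->
  k v - k w <= x * (v - w).
Proof.
move=> wv vG; rewrite leNgt; apply/negP => xs.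
have : steep x v.
  right; split; last by exists w.
  rewrite (lt_le_trans vG) ?slope_inverse_le1// andbT.
  by case/andP: wv; exact: lt_trans.
by move/slope_inverse_le; rewrite leNgt vG.
Qed.

Lemma slope_inverse_nd : {homo G : x y / x <= y}.
Proof.
move=> x y xy; apply: slope_inverse_ge => v yv; apply: slope_inverse_le.
case: yv => [->|[v01 [w /[dup] wv /andP[_ ltwv] ywv]]]; first exact: steep1.
right; split => //; exists w => //; apply: le_lt_trans ywv.
by rewrite ler_wpM2r// subr_ge0 ltW.
Qed.

(** The strict inequality in [steep] matters: a chord steeper than [x] is still steeper than every
    [y] slightly above [x]. *)
Lemma slope_inverse_rc : right_continuous G.
Proof.
move=> x; apply/cvgrPdist_lt => e e0.
have [v xv vG] := inf_adherent e0 (has_inf_steep x).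
have : \forall y \near x^'+, G y <= v.
  case: xv vG => [-> _|[v01 [w /[dup] wv /andP[_ ltwv] xwv]] _].
    by near=> y; exact: slope_inverse_le1.
  near=> y; apply: slope_inverse_le; right; split => //; exists w => //.
  rewrite -ltr_pdivlMr ?subr_gt0//; near: y; apply: nbhs_right_lt.
  by rewrite ltr_pdivlMr ?subr_gt0.
move=> Gv; near=> y.
have xy : x <= y by near: y; exact: nbhs_right_ge.
rewrite distrC ger0_norm ?subr_ge0 ?slope_inverse_nd// ltrBlDl.
by apply: le_lt_trans vG; near: y.
Unshelve. all: by end_near. Qed.

Lemma cvg_slope_inverseNy : G x @[x --> -oo] --> (0 : R).
Proof.
apply/cvgrPdist_le => e e0.
(* The cap 1/2 keeps [v] below 1. Once [x] is below the slope of the chord over [[v / 2, v]], the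
   point [v] is in [steep x]. *)
pose v := Num.min e 2^-1.
have v0 : 0 < v by rewrite lt_min e0 invr_gt0/= ltr0n.
have v1 : v < 1 by rewrite gt_min invf_lt1 ?ltr0n ?ltr1n ?orbT.
near=> x; rewrite sub0r normrN ger0_norm ?slope_inverse_ge0//.
apply: (@le_trans _ _ v); last by rewrite ge_min lexx.
apply: slope_inverse_le; right; split; first by rewrite v0.
exists (v / 2); first by rewrite divr_gt0//= ltr_pdivrMr// ltr_pMr// ltr1n.
rewrite -ltr_pdivlMr; last by rewrite subr_gt0 ltr_pdivrMr// ltr_pMr// ltr1n.
by near: x; apply: nbhs_ninfty_lt; exact: num_real.
Unshelve. all: by end_near. Qed.

(** * Convergence of the distribution functions to the inverse slope *)

Context (d : nat -> measure_display)
  (T : forall n, measurableType (d n)) (P : forall n, probability (T n) R)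
  (X : forall n, {RV (P n) >-> R}) (c : nat -> R).
Hypothesis Kk : forall u, 0 < u < 1 ->
  rquantile (X n) u - c n @[n --> \oo] --> k u.

Lemma cvg_rquantile_chord w v : 0 < w < 1 -> 0 < v < 1 ->
  rquantile (X n) v - rquantile (X n) w @[n --> \oo] --> k v - k w.
Proof.
move=> w01 v01; rewrite [X in X @ _](_ : _ = fun n =>
  (rquantile (X n) v - c n) - (rquantile (X n) w - c n)).
  by apply: cvgB; exact: Kk.
by apply/funext => n; rewrite opprB addrA subrK.
Qed.

(** If [v <= F_n x], the chord of [K_n] over [[w, v]] has slope at most [x], but its limit slope
    exceeds [x]. *)
Lemma rcdf_le_steep x v : steep x v -> \forall n \near \oo, rcdf (X n) x <= v.
Proof.
move=> [->|[v01 [w /andP[w0 wv] xwv]]]; first by near=> n; exact: rcdf_le1.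
have /andP[v0 v1] := v01.
have w01 : 0 < w < 1 by rewrite w0 (lt_trans wv).
near=> n; rewrite leNgt; apply/negP => /ltW vF.
have := integrated_quantile_slope_le w0 (ltW wv) v1 vF.
rewrite leNgt => /negP; apply; near: n.
by move/cvgr_gt : (cvg_rquantile_chord w01 v01); exact.
Unshelve. all: by end_near. Qed.

Lemma rcdf_gt_chord x w v : 0 < w -> w < v -> v < 1 ->
  k v - k w < x * (v - w) -> \forall n \near \oo, w < rcdf (X n) x.
Proof.
move=> w0 wv v1 kx.
have w01 : 0 < w < 1 by rewrite w0 (lt_trans wv).
have v01 : 0 < v < 1 by rewrite v1 (lt_trans w0).
near=> n; rewrite ltNge; apply/negP => Fw.
have := integrated_quantile_slope_ge w0 (ltW wv) v1 Fw.
rewrite leNgt => /negP; apply; near: n.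
by move/cvgr_lt : (cvg_rquantile_chord w01 v01); exact.
Unshelve. all: by end_near. Qed.

(* Comparison with [F_n], which exceeds [v] at a large [x] for all large [n],
   replaces the convexity of [k]. *)
Lemma cvg_slope_inversey : G x @[x --> +oo] --> (1 : R).
Proof.
apply/cvgrPdist_le => e e0.
(* The bound 1/2 keeps [v] positive when [e >= 1]; [v2] supplies a chord over [[v, v2]], whose slope
   a large [x] exceeds. *)
pose v := Num.max (1 - e) 2^-1.
have v0 : 0 < v by rewrite lt_max invr_gt0 ltr0n orbT.
have v1 : v < 1.
  by rewrite gt_max invf_lt1 ?ltr0n ?ltr1n ?andbT// ltrBlDr ltrDl.
pose v2 := (v + 1) / 2.
have vv2 : v < v2 by rewrite /v2; lra.
have v21 : v2 < 1 by rewrite /v2; lra.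
near=> x.
have vFn : \forall n \near \oo, v < rcdf (X n) x.
  apply: (rcdf_gt_chord v0 vv2 v21).
  rewrite -ltr_pdivrMr ?subr_gt0//; near: x.
  by apply: nbhs_pinfty_gt; exact: num_real.
rewrite ger0_norm ?subr_ge0 ?slope_inverse_le1// lerBlDl -lerBlDr.
apply: (@le_trans _ _ v); first by rewrite le_max lexx.
apply: slope_inverse_ge => v' xv'.
have v'Fn := rcdf_le_steep xv'.
near \oo => n; apply: (@le_trans _ _ (rcdf (X n) x)); last by near: n.
by apply/ltW; near: n.
Unshelve. all: by end_near. Qed.

(** The upper bound comes from a point of [steep x] close to its infimum; only the lower bound uses
    continuity, to find [y < x] with [G y] close to [G x]. *)
Lemma cvg_rcdf_slope_inverse x : {for x, continuous G} ->
  rcdf (X n) x @[n --> \oo] --> G x.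
Proof.
move=> Gx; apply/cvgrPdist_le => e e0.
have [v xv vG] := inf_adherent e0 (has_inf_steep x).
have Fv := rcdf_le_steep xv.
have Fl : \forall n \near \oo, G x - e <= rcdf (X n) x.
  have [Gxe|eGx] := ltP (G x - e) 0.
    by near=> n; rewrite (le_trans (ltW Gxe)) ?rcdf_ge0.
  have Gl : G y @[y --> x^'-] --> G x by exact: cvg_at_left_filter.
  have [y yx Gy] : exists2 y, y < x & G x - e < G y.
    near x^'- => y; exists y.
      by near: y; exact: nbhs_left_lt.
    near: y; move/cvgr_gt : Gl; apply; by rewrite ltrBlDr ltrDl.
  (* Both points lie between [G x - e] and [G y]. The chord over [[w, v']], being below [G y], has
     slope at most [y], hence less than [x]. *)
  pose w := (G x - e + G y) / 2; pose v' := (w + G y) / 2.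
  have Gy1 := slope_inverse_le1 y.
  have w0 : 0 < w by rewrite /w; lra.
  have wv' : w < v' by rewrite /v' /w; lra.
  have v'G : v' < G y by rewrite /v' /w; lra.
  have : \forall n \near \oo, w < rcdf (X n) x.
    apply: (rcdf_gt_chord w0 wv' (lt_le_trans v'G Gy1)).
    apply: le_lt_trans (slope_inverse_lt_notin _ v'G) _; first by rewrite w0.
    by rewrite ltr_pM2r// subr_gt0.
  by apply: filterS => n /ltW; apply: le_trans; rewrite /w; lra.
near=> n; rewrite ler_distlC; apply/andP; split; first by near: n.
by apply/(le_trans _ (ltW vG)); near: n.
Unshelve. all: by end_near. Qed.

Lemma weakly_convergent_cvg_quantile : weakly_convergent X.
Proof.
(* The limits 0 and 1 of [G] make its Lebesgue-Stieltjes measure a probability, under which the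
   identity has distribution function [G]. *)
pose f : cumulativeBounded (0 : R) (1 : R) := HB.pack G
  (isCumulative.Build R _ R G slope_inverse_nd slope_inverse_rc)
  (isCumulativeBounded.Build R 0 1 G cvg_slope_inverseNy cvg_slope_inversey).
have [Y YG] : exists Y : {RV (lebesgue_stieltjes_measure f) >-> R},
    forall r, cdf Y r = (G r)%:E.
  by eexists; exact: (cdf_lebesgue_stieltjes_id f).
exists _, _, _, Y => x; rewrite /prop_for /continuous_at YG => Yx.
rewrite (_ : (fun n => cdf (X n) x) = EFin \o (fun n => rcdf (X n) x));
    last first.
  by apply/funext => n /=; rewrite /rcdf fineK ?fin_num_measure.
apply: cvg_EFin; first by near=> n.
apply: cvg_rcdf_slope_inverse.
rewrite (_ : cdf Y = EFin \o G) in Yx; last by apply/funext => r; rewrite YG.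
exact: fine_cvg Yx.
Unshelve. all: by end_near. Qed.

End limit_distribution.

(** * The equivalences, by the cycle (i), (iii), (ii), (i), and the limit *)

Theorem theorem9 (R : realType) (d : nat -> measure_display)
    (T : forall n, measurableType (d n)) (P : forall n, probability (T n) R)
    (X : forall n, {RV (P n) >-> R}) :
  let i := weakly_convergent X in
  let ii := exists c : nat -> R, forall u : R, 0 < u < 1 ->
    exists l : R,
      (integrated_quantile (X n) u - (c n)%:E)%E @[n --> \oo] --> l%:E in
  let iii := forall alpha beta : R, `[alpha, beta] `<=` `]0, 1[ ->
    exists k : R -> R,
      {uniform `[alpha, beta],
        (fun n u => fine (integrated_quantile (X n) u)) @ \oo --> k} in
  [/\ i <-> ii, i <-> iii &
    forall (d' : measure_display) (T' : measurableType d')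
      (Q : probability T' R) (Y : {RV Q >-> R}),
      cvg_in_distribution X Y ->
      forall u : R, 0 < u < 1 ->
        integrated_quantile (X n) u @[n --> \oo] --> integrated_quantile Y u].
Proof.
move=> i ii iii.
have i_iii : i -> iii.
  move=> [d' [T' [Q [Y XY]]]] alpha beta ab01.
  by exists (rquantile Y); exact: uniform_cvg_rquantile XY _ _ ab01.
have iii_ii : iii -> ii.
  (* No centering is required: uniform convergence on the degenerate interval [[u, u]] is
     convergence at [u]. *)
  move=> XK; exists (fun=> 0) => u u01.
  have [k] : exists k : R -> R, {uniform `[u, u],
      (fun n u => fine (integrated_quantile (X n) u)) @ \oo --> k}.
    by apply: XK => v; rewrite /= !in_itv/= => /le_anti <-.
  rewrite set_itv1 uniform_set1 => XKu; exists (k u).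
  apply/cvg_EFin.
    near=> n; rewrite sube0; exact: integrated_quantile_fin_num.
  by under eq_fun do rewrite /= sube0.
have ii_i : ii -> i.
  move=> [c XK].
  have /choice[k Kk] : forall u, exists l : R, 0 < u < 1 ->
      rquantile (X n) u - c n @[n --> \oo] --> l.
    (* Outside (0, 1) the value of the limit function is arbitrary. *)
    move=> u; have [u01|_] := boolP (0 < u < 1); last by exists 0.
    have [l /fine_cvg Xl] := XK _ u01; exists l => _.
    move: Xl; apply: cvg_trans; apply: near_eq_cvg; near=> n => /=.
    by rewrite fineD// integrated_quantile_fin_num.
  exact: weakly_convergent_cvg_quantile Kk.
split; [by split=> [/i_iii/iii_ii|/ii_i]|by split=> [/i_iii|/iii_ii/ii_i]|].
by move=> d' T' Q Y XY u u01; exact: cvg_integrated_quantile.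
Unshelve. all: by end_near. Qed.
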